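(* There exists a functor from the category $\mathfrak{S}Ext$ of cosimplicial $\mathfrak S$-extensions to the category $VExt$ of extensions of Thompson's group $V$, which maps a cosimplicial $\mathfrak{S}$-extension $(1\to K_n\to G_n\to\mathfrak S_n\to 1)_{n\ge1}$ to an extension of Thompson's group $V$ by $K_\infty$, $$1\to K_\infty\to G[V]\to V\to 1,$$ which is split over Thompson's group $F$ (here $K_\infty$ and $G[V]$ are the groups attached to the cosimplicial $\mathfrak S$-extension, defined in the context). In particular, the correspondence which associates the group $G[V]$ to the cosimplicial $\mathfrak S$-extension is a functor from $\mathfrak SExt$ to the category of groups.
   Context: **Strand doubling.** For $\sigma\in\mathfrak S_n$ (the symmetric group on $\{1,\dots,n\}$) and $1\le i\le n$, $\partial^i_n(\sigma)\in\mathfrak S_{n+1}$ is obtained by duplicating $i$ in the source, replacing it by $i_l<i_r$, and $j=\sigma(i)$ in the target, replacing it by $j_l<j_r$ (placed where $i$, resp. $j$, was in the order), extending $\sigma$ by $i_l\mapsto j_l$, $i_r\mapsto j_r$, and renumbering source and target in increasing order by $1,\dots,n+1$. **Cosimplicial $\mathfrak S$-extension.** A family of group extensions $1\to K_n\to G_n\to\mathfrak S_n\to1$, $n\ge1$ (write $\bar g\in\mathfrak S_n$ for the image of $g\in G_n$), such that: 1. For all $i=1,\dots,n$ the strand doubling map $\partial^i_n:\mathfrak S_n\to\mathfrak S_{n+1}$ admits a lift, still denoted $\partial^i_n:G_n\to G_{n+1}$, which verifies $\partial^i_n(gh)=\partial^{\bar h(i)}_n(g)\,\partial^i_n(h)$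 for all $g,h\in G_n$. In particular each $\partial^i_n$ restricts to a group morphism $K_n\to K_{n+1}$. 2. There exist morphisms (codegeneracies) $\varepsilon^i_n:K_n\to K_{n-1}$, $i=1,\dots,n$, such that $(K_n,\partial^i_n,\varepsilon^i_n,\ n\ge1)$ is a cosimplicial group, i.e. the usual cosimplicial identities hold on the groups $K_n$; in particular $\partial^j_{n+1}\circ\partial^i_n=\partial^{i+1}_{n+1}\circ\partial^j_n$ on $K_n$ for $j<i$, and $\varepsilon^i_{n+1}\circ\partial^i_n=\mathrm{id}$ on $K_n$, so that $\partial^i_n:K_n\to K_{n+1}$ is injective. $\mathfrak SExt$ is the category of cosimplicial $\mathfrak S$-extensions, its morphisms being the families of morphisms of extensions compatible with this structure. **$VExt$.** Objects are short exact sequences of groups $1\to K\to G\to V\to1$; morphisms are commutative diagrams of short exact sequences. **Trees.** An $n$-tree is a finite subtree, containing the root, of the infinite planar rooted dyadic tree $\mathcal T_0$ (all vertices except the root 3-valent), having $n$ leaves, whose vertices other than the root and the leaves are 3-valent; its leaves are labelled $1,\dots,n$ from left to right. $\partial^i_n(\tau)$ is the $(n+1)$-tree obtained from the $n$-tree $\tau$ by grafting two edges at its $i$-th leaf (simple expansion). $\tau'$ is an expansion of $\tau$ if it is obtained from $\tau$ by finitely many (possibly zero) simple expansions. Trees ordered by expansion form a directed set; $|\tau|$ is the number of leaves of $\tau$. (One may equally use finite unrooted dyadic trees, i.e. finite subtrees, all of whose non-leaf vertices are 3-valent, of the regular trivalent planar tree $\mathcal T\supset\mathcal T_0$ containing the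 edge of $\mathcal T$ that is incident to the root of $\mathcal T_0$ but not in $\mathcal T_0$, with leaves labelled in the order given by the orientation of the plane, the leftmost leaf in $\mathcal T_0$ being labelled 1; the groups and exact sequences below are the same up to isomorphism.) **$K_\infty$.** The colimit over the directed set of trees of the groups ${\bf K}(\tau)=K_{|\tau|}$, where an expansion $\tau'=\partial^{i_{k+1}}_{n+k}\cdots\partial^{i_2}_{n+1}\partial^{i_1}_n(\tau)$ induces the homomorphism $\partial^{i_{k+1}}_{n+k}\circ\cdots\circ\partial^{i_2}_{n+1}\circ\partial^{i_1}_n:K_n\to K_{n+k+1}$, which does not depend on the choice of the simple expansions connecting $\tau$ to $\tau'$. **$G[V]$.** A $G$-symbol of level $n$ is a triple $(\tau_1,\tau_0,g)$ with $\tau_0,\tau_1$ two $n$-trees and $g\in G_n$. Let $[\tau_1,\tau_0,g]$ be its class under the equivalence relation generated by $(\tau_1,\tau_0,g)\sim(\partial_n^{\bar g(i)}(\tau_1),\partial^i_n(\tau_0),\partial^i_n(g))$, $n\ge1$, $1\le i\le n$. $G[V]$ is the set of classes with product $[\tau_2,\tau_1,g]\cdot[\tau_1,\tau_0,h]=[\tau_2,\tau_0,gh]$ (after replacing both symbols by equivalent ones so that the middle trees agree). For $G_n=\mathfrak S_n$ (so $K_n=\{1\}$) this group is Thompson's group $V$, and Thompson's group $F\subset V$ is the subgroup of elements $[\tau_1,\tau_0,1_n]$ (with $1_n$ the neutral element). The map $K_\infty\to G[V]$ is induced by $k\in{\bf K}(\tau)\mapsto[\tau,\tau,k]$, and $G[V]\to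 V$ is $[\tau_1,\tau_0,g]\mapsto[\tau_1,\tau_0,\bar g]$. ''Split over $F$'' means that there is a homomorphism $F\to G[V]$ whose composition with $G[V]\to V$ is the inclusion.
   Formalization: The identity ∂^j∂^i = ∂^{i+1}∂^j (j<i) is required on all of G_n, not only on K_n: without it K_∞ → G[V] is not injective (e.g. suitable twisted doublings on Z × S_n). Morphisms of S-extensions are taken to be the identity on S_n. *)

(* Defs.v *)
From HB Require Import structures.
From Stdlib Require Import Relation_Operators.
From Stdlib Require Eqdep_dec PeanoNat.
From mathcomp Require Import all_boot perm boolp zify.

Set Implicit Arguments.
Unset Strict Implicit.
Unset Printing Implicit Defensive.

Local Open Scope group_scope.

(* The symmetric group with the product (s * t) i = s (t i).  The product of
   MathComp's own group 'S_n is the opposite one. *)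
Definition sym (n : nat) : Type := 'S_n.

HB.instance Definition _ n := Choice.copy (sym n) 'S_n.

Section Sym.
Variable n : nat.
Definition sym_mul (s t : sym n) : sym n := ((t : 'S_n) * (s : 'S_n)).
Definition sym_one : sym n := (1 : 'S_n).
Definition sym_inv (s : sym n) : sym n := (s : 'S_n)^-1.
Lemma sym_mulA : associative sym_mul.
Proof. by move=> a b c; rewrite /sym_mul mulgA. Qed.
Lemma sym_mul1g : left_id sym_one sym_mul.
Proof. by move=> a; rewrite /sym_mul mulg1. Qed.
Lemma sym_mulg1 : right_id sym_one sym_mul.
Proof. by move=> a; rewrite /sym_mul mul1g. Qed.
Lemma sym_mulVg : left_inverse sym_one sym_inv sym_mul.
Proof. by move=> a; rewrite /sym_mul /sym_inv mulgV. Qed.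
Lemma sym_mulgV : right_inverse sym_one sym_inv sym_mul.
Proof. by move=> a; rewrite /sym_mul /sym_inv mulVg. Qed.
HB.instance Definition _ :=
  isGroup.Build (sym n) sym_mulA sym_mul1g sym_mulg1 sym_mulVg sym_mulgV.
End Sym.

Definition sym_app n (s : sym n) (i : 'I_n) : 'I_n := (s : 'S_n) i.

Lemma sym_mulE n (s t : sym n) i : sym_app (s * t) i = sym_app s (sym_app t i).
Proof. by rewrite /sym_app permM. Qed.

Lemma sym_appK n (s : sym n) : cancel (sym_app s) (sym_app s^-1).
Proof. exact: permK. Qed.

Lemma sym_appKV n (s : sym n) : cancel (sym_app s^-1) (sym_app s).
Proof. exact: permKV. Qed.

Lemma sym_app1 n i : sym_app (1 : sym n) i = i.
Proof. exact: perm1. Qed.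

(* The index with the same value, resp. with the value increased by one. *)
Notation same i := (widen_ord (leqnSn _) i).
Notation next i := (lift ord0 i).

(* lift_perm a b s inserts a new point a in the source and a new point b in the
   target, and sends a to b.  Here the new points are i_r = i + 1, put right
   after i_l = i, and j_r = j + 1, put right after j_l = j, where j = s i. *)
Definition double n (i : 'I_n) (s : sym n) : sym n.+1 :=
  lift_perm (next i) (next (sym_app s i)) s.

Lemma mult1 (G H : groupType) (f : {multiplicative G -> H}) : f 1 = 1.
Proof.
have := @gmulfM _ _ f 1 1; rewrite mulg1 => /(congr1 (fun x => x / f 1)).
by rewrite mulgK mulgV => ->.
Qed.

Lemma multV (G H : groupType) (f : {multiplicative G -> H}) x : f x^-1 = (f x)^-1.
Proof. by apply: (mulgI (f x)); rewrite -gmulfM !mulgV mult1. Qed.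

Definition short_exact (K G Q : groupType)
    (i : {multiplicative K -> G}) (p : {multiplicative G -> Q}) : Prop :=
  [/\ injective i,
      forall g : G, p g = 1 <-> exists k : K, i k = g
    & forall q : Q, exists g : G, p g = q].

(* Strands are numbered from 0, and the groups of index n below are those on
   n + 1 strands, so that the families start with the groups on one strand.
   The codegeneracies start with those from two strands to one.

   [ce_doubleK] is the restriction of [ce_double] to the kernels; it is
   determined by [ce_iota_double], as [ce_iota] is injective.

   There are m doublings and m codegeneracies out of the group on m strands.
   For these index ranges, the mixed identities that make sense for all indices
   are those of strand doubling and strand deletion: doubling the strand i and
   then deleting either of the two resulting strands i, i + 1 is the identity,
   and the other pairs commute up to the renumbering.

   [ce_double_comm] is required on the whole of G and not only on the kernel:
   if it failed for some g, the two sides would be the entries of equivalent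
   symbols with the same trees, and the element of the kernel by which they
   differ would be non-trivial in K_oo but trivial in G[V]. *)
Record cosimplicial_ext := CosimplicialExt {
  ce_K : nat -> groupType;
  ce_G : nat -> groupType;
  ce_iota : forall n, {multiplicative ce_K n -> ce_G n};
  ce_bar : forall n, {multiplicative ce_G n -> sym n.+1};
  ce_exact : forall n, short_exact (ce_iota n) (ce_bar n);

  ce_double : forall n, 'I_n.+1 -> ce_G n -> ce_G n.+1;
  ce_bar_double : forall n (i : 'I_n.+1) (g : ce_G n),
    ce_bar n.+1 (ce_double i g) = double i (ce_bar n g);
  ce_doubleM : forall n (i : 'I_n.+1) (g h : ce_G n),
    ce_double i (g * h)
    = ce_double (sym_app (ce_bar n h) i) g * ce_double i h;
  ce_double_comm : forall n (i j : 'I_n.+1) (g : ce_G n), (j < i)%N ->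
    ce_double (same j) (ce_double i g) = ce_double (next i) (ce_double j g);

  ce_doubleK : forall n, 'I_n.+1 -> {multiplicative ce_K n -> ce_K n.+1};
  ce_iota_double : forall n (i : 'I_n.+1) (k : ce_K n),
    ce_iota n.+1 (ce_doubleK i k) = ce_double i (ce_iota n k);
  ce_codegen : forall n, 'I_n.+2 -> {multiplicative ce_K n.+1 -> ce_K n};

  ce_doubleK_doubleK : forall n (i j : 'I_n.+1) (k : ce_K n), (j <= i)%N ->
    ce_doubleK (same j) (ce_doubleK i k)
    = ce_doubleK (next i) (ce_doubleK j k);
  ce_codegen_codegen : forall n (i j : 'I_n.+2) (k : ce_K n.+2), (i <= j)%N ->
    ce_codegen j (ce_codegen (same i) k) = ce_codegen i (ce_codegen (next j) k);
  ce_codegen_doubleK_lt : forall n (i j : 'I_n.+1) (k : ce_K n.+1),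
    (i <= j)%N ->
    ce_codegen (same (same i)) (ce_doubleK (next j) k)
    = ce_doubleK j (ce_codegen (same i) k);
  ce_codegen_doubleK_l : forall n (i : 'I_n.+1) (k : ce_K n),
    ce_codegen (same i) (ce_doubleK i k) = k;
  ce_codegen_doubleK_r : forall n (i : 'I_n.+1) (k : ce_K n),
    ce_codegen (next i) (ce_doubleK i k) = k;
  ce_codegen_doubleK_gt : forall n (i : 'I_n.+2) (j : 'I_n.+1)
      (k : ce_K n.+1), (j < i)%N ->
    ce_codegen (next i) (ce_doubleK (same j) k)
    = ce_doubleK j (ce_codegen i k)
}.

Arguments ce_doubleK {c n} i.
Arguments ce_codegen {c n} i.

Record cosimplicial_hom (E E' : cosimplicial_ext) := CosimplicialHom {
  ch_K : forall n, {multiplicative ce_K E n -> ce_K E' n};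
  ch_G : forall n, {multiplicative ce_G E n -> ce_G E' n};
  ch_iota : forall n (k : ce_K E n),
    ch_G n (ce_iota E n k) = ce_iota E' n (ch_K n k);
  ch_bar : forall n (g : ce_G E n), ce_bar E' n (ch_G n g) = ce_bar E n g;
  ch_double : forall n (i : 'I_n.+1) (g : ce_G E n),
    ch_G n.+1 (ce_double i g) = ce_double i (ch_G n g);
  ch_codegen : forall n (i : 'I_n.+2) (k : ce_K E n.+1),
    ch_K n (ce_codegen i k) = ce_codegen i (ch_K n.+1 k)
}.

(* A finite subtree of the planar rooted dyadic tree that contains the root and
   all of whose vertices other than the root and the leaves are 3-valent is
   given by its shape.  [Leaf] is the tree reduced to the root, with one leaf;
   in all the others the root has its two sons, otherwise the trees would not
   form a directed set. *)
Inductive tree : Type := Leaf | Node of tree & tree.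

Fixpoint leaves (t : tree) : nat :=
  if t is Node l r then (leaves l + leaves r)%N else 1%N.

(* Leaves are counted from 0, from left to right. *)
Fixpoint expand_tree (i : nat) (t : tree) : tree :=
  if t is Node l r then
    if (i < leaves l)%N then Node (expand_tree i l) r
    else Node l (expand_tree (i - leaves l) r)
  else Node Leaf Leaf.

Lemma leaves_expand i t : leaves (expand_tree i t) = (leaves t).+1.
Proof.
elim: t i => [|l IHl r IHr] i //=.
by case: ifP => _ /=; rewrite ?IHl ?IHr ?addSn ?addnS.
Qed.

(* The trees with n + 1 leaves. *)
Record ntree (n : nat) := NTree {
  tree_of :> tree;
  ntreeP : leaves tree_of == n.+1
}.

Lemma ntree_inj n : injective (@tree_of n).
Proof.
move=> [t p] [u q] /= tu; rewrite tu in p *.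
by congr NTree; apply: bool_irrelevance.
Qed.

Fact expand_subproof n (i : 'I_n.+1) (t : ntree n) :
  leaves (expand_tree i t) == n.+2.
Proof. by rewrite leaves_expand (eqP (ntreeP t)). Qed.

Definition expand n (i : 'I_n.+1) (t : ntree n) : ntree n.+1 :=
  NTree (expand_subproof i t).

Definition root_tree : ntree 0 := NTree (erefl : leaves Leaf == 1%N).

Lemma leaves_gt0 t : (0 < leaves t)%N.
Proof. by elim: t => //= l IHl r IHr; rewrite addn_gt0 IHl. Qed.

Fixpoint tsub (t u : tree) : bool :=
  match t, u with
  | Leaf, _ => true
  | Node l r, Node l' r' => tsub l l' && tsub r r'
  | Node _ _, Leaf => false
  end.

Fixpoint tjoin (t u : tree) : tree :=
  match t, u with
  | Leaf, _ => u
  | _, Leaf => t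
  | Node l r, Node l' r' => Node (tjoin l l') (tjoin r r')
  end.

Lemma tsub_refl t : tsub t t.
Proof. by elim: t => //= l -> r ->. Qed.

Lemma tsub_trans t u v : tsub t u -> tsub u v -> tsub t v.
Proof.
elim: t u v => [|l IHl r IHr] [|l1 r1] [|l2 r2] //= /andP[a b] /andP[c d].
by rewrite (IHl _ _ a c) (IHr _ _ b d).
Qed.

Lemma tsub_joinl t u : tsub t (tjoin t u).
Proof. by elim: t u => [|l IHl r IHr] [|l1 r1] //=; rewrite ?tsub_refl ?IHl ?IHr. Qed.

Lemma tsub_joinr t u : tsub u (tjoin t u).
Proof. by elim: t u => [|l IHl r IHr] [|l1 r1] //=; rewrite ?tsub_refl ?IHl ?IHr. Qed.

Lemma tsub_expand i t : tsub t (expand_tree i t).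
Proof.
elim: t i => [|l IHl r IHr] i //=.
by case: ifP => _ /=; rewrite ?tsub_refl ?IHl ?IHr.
Qed.

Lemma tsub_leaves t u : tsub t u -> (leaves t <= leaves u)%N.
Proof.
elim: t u => [|l IHl r IHr] [|l1 r1] //=; first by rewrite addn_gt0 leaves_gt0.
by move=> /andP[a b]; apply: leq_add; [apply: IHl | apply: IHr].
Qed.

Lemma expand_tree_comm i j t : (j < i)%N -> (i < leaves t)%N ->
  expand_tree j (expand_tree i t) = expand_tree i.+1 (expand_tree j t).
Proof.
elim: t i j => [|l IHl r IHr] i j /= ji it.
  by case: i ji it => [|i] //.
case: (ltnP i (leaves l)) => il.
  have jl := ltn_trans ji il.
  by rewrite jl /= !leaves_expand (leqW jl) ltnS il IHl.
case: (ltnP j (leaves l)) => jl /=.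
  by rewrite leaves_expand jl ltnS ltnNge il /= subSS.
rewrite ltnNge jl ltnNge leqW //= subSn // IHr //; last by rewrite ltn_subLR.
by rewrite ltn_sub2r // (leq_ltn_trans jl).
Qed.

Lemma tsub_expand2 i j t u : (j < i)%N -> (i < leaves t)%N ->
  tsub (expand_tree i t) u -> tsub (expand_tree j t) u ->
  tsub (expand_tree j (expand_tree i t)) u.
Proof.
elim: t i j u => [|l IHl r IHr] i j u /= ji it.
  by case: i ji it => [|i].
case: (ltnP i (leaves l)) => il.
  have jl := ltn_trans ji il.
  rewrite jl /= leaves_expand (leqW jl) /=.
  by case: u => //= l' r' /andP[a ->] /andP[b _]; rewrite IHl.
case: (ltnP j (leaves l)) => jl /=.
  by rewrite jl; case: u => //= l' r' /andP[a b] /andP[c d]; rewrite c b.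
rewrite ltnNge jl /=.
case: u => //= l' r' /andP[-> b] /andP[_ d] /=; apply: IHr => //.
  by rewrite ltn_sub2r // (leq_ltn_trans jl).
by rewrite ltn_subLR.
Qed.

Lemma tsub_step t u : tsub t u -> t = u \/
  exists2 i, (i < leaves t)%N & tsub (expand_tree i t) u.
Proof.
elim: t u => [|l IHl r IHr] [|l1 r1] //=; first by left.
  by right; exists 0%N.
move=> /andP[a b].
case: (IHl _ a) => [<-|[i il ai]]; last first.
  right; exists i; first by rewrite (leq_trans il) // leq_addr.
  by rewrite il /= ai b.
case: (IHr _ b) => [<-|[i il ai]]; first by left.
right; exists (leaves l + i)%N; first by rewrite ltn_add2l.
by rewrite ltnNge leq_addr /= addKn tsub_refl ai.
Qed.

(* The groups K_oo and G[V] are built in the same way, from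
   - for each n, symbols with a source and a target tree, which form a groupoid
     on the trees with n + 1 leaves (the operation [sg_mul] is only meaningful
     when the source of the left factor is the target of the right one);
   - expansions of symbols at the leaves of their source trees, [sg_act] being
     the induced bijection from the leaves of the source to those of the
     target. *)
Record symbols := Symbols {
  sg_car :> nat -> Type;
  sg_src : forall n, sg_car n -> ntree n;
  sg_tgt : forall n, sg_car n -> ntree n;
  sg_act : forall n, sg_car n -> 'I_n.+1 -> 'I_n.+1;
  sg_mul : forall n, sg_car n -> sg_car n -> sg_car n;
  sg_one : forall n, ntree n -> sg_car n;
  sg_inv : forall n, sg_car n -> sg_car n;
  sg_expand : forall n, 'I_n.+1 -> sg_car n -> sg_car n.+1;
  sg_src_mul : forall n (x y : sg_car n), sg_src x = sg_tgt y ->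
    sg_src (sg_mul x y) = sg_src y;
  sg_tgt_mul : forall n (x y : sg_car n), sg_src x = sg_tgt y ->
    sg_tgt (sg_mul x y) = sg_tgt x;
  sg_src_one : forall n (t : ntree n), sg_src (sg_one t) = t;
  sg_tgt_one : forall n (t : ntree n), sg_tgt (sg_one t) = t;
  sg_src_inv : forall n (x : sg_car n), sg_src (sg_inv x) = sg_tgt x;
  sg_tgt_inv : forall n (x : sg_car n), sg_tgt (sg_inv x) = sg_src x;
  sg_mulA : forall n (x y z : sg_car n),
    sg_mul x (sg_mul y z) = sg_mul (sg_mul x y) z;
  sg_mul1g : forall n (x : sg_car n), sg_mul (sg_one (sg_tgt x)) x = x;
  sg_mulg1 : forall n (x : sg_car n), sg_mul x (sg_one (sg_src x)) = x;
  sg_mulVg : forall n (x : sg_car n), sg_mul (sg_inv x) x = sg_one (sg_src x);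
  sg_mulgV : forall n (x : sg_car n), sg_mul x (sg_inv x) = sg_one (sg_tgt x);
  sg_actK : forall n (x : sg_car n), cancel (sg_act x) (sg_act (sg_inv x));
  sg_actKV : forall n (x : sg_car n), cancel (sg_act (sg_inv x)) (sg_act x);
  sg_src_expand : forall n (i : 'I_n.+1) (x : sg_car n),
    sg_src (sg_expand i x) = expand i (sg_src x);
  sg_tgt_expand : forall n (i : 'I_n.+1) (x : sg_car n),
    sg_tgt (sg_expand i x) = expand (sg_act x i) (sg_tgt x);
  sg_expandM : forall n (i : 'I_n.+1) (x y : sg_car n), sg_src x = sg_tgt y ->
    sg_expand i (sg_mul x y) = sg_mul (sg_expand (sg_act y i) x) (sg_expand i y);
  sg_expand1 : forall n (i : 'I_n.+1) (t : ntree n),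
    sg_expand i (sg_one t) = sg_one (expand i t);
  sg_expand_comm : forall n (i j : 'I_n.+1) (x : sg_car n), (j < i)%N ->
    sg_expand (same j) (sg_expand i x) = sg_expand (next i) (sg_expand j x)
}.

Arguments sg_one {s n} t.

Lemma sg_invK (S : symbols) n (x : S n) : sg_inv (sg_inv x) = x.
Proof.
rewrite -[LHS]sg_mulg1 sg_src_inv sg_tgt_inv -sg_mulVg sg_mulA sg_mulVg.
by rewrite sg_src_inv sg_mul1g.
Qed.

Section Classes.
Variable S : symbols.

Record psymbol := PSymbol { ps_level : nat; ps_val : S ps_level }.

HB.instance Definition _ := gen_eqMixin psymbol.
HB.instance Definition _ := gen_choiceMixin psymbol.

Definition simple_expansion (x y : psymbol) : Prop :=
  exists i : 'I_(ps_level x).+1, y = PSymbol (sg_expand i (ps_val x)).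

Definition equivalent : psymbol -> psymbol -> Prop :=
  clos_refl_sym_trans psymbol simple_expansion.

Definition equivalentb (x y : psymbol) : bool := `[< equivalent x y >].

Lemma equivalentb_refl : reflexive equivalentb.
Proof. by move=> x; apply/asboolP; apply: rst_refl. Qed.
Lemma equivalentb_sym : symmetric equivalentb.
Proof.
by move=> x y; apply/asboolP/asboolP => xy; apply: rst_sym.
Qed.
Lemma equivalentb_trans : transitive equivalentb.
Proof.
move=> y x z /asboolP xy /asboolP yz; apply/asboolP.
by apply: rst_trans xy yz.
Qed.

Canonical equivalent_rel :=
  EquivRel equivalentb equivalentb_refl equivalentb_sym equivalentb_trans.

Definition classes : Type := {eq_quot equivalent_rel}%qT.

HB.instance Definition _ := Choice.on classes.

Definition psclass (x : psymbol) : classes :=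
  (\pi_({eq_quot equivalent_rel}) x)%qT.

Definition class_of n (x : S n) : classes := psclass (PSymbol x).

Lemma psclass_eq x y : psclass x = psclass y <-> equivalent x y.
Proof. by split=> [/eqquotP/asboolP|xy] //; apply/eqquotP/asboolP. Qed.

Lemma class_ofP (a : classes) : exists n (x : S n), a = class_of x.
Proof.
elim/quotW: a => -[n x]; by exists n, x.
Qed.

Definition reach : psymbol -> psymbol -> Prop :=
  clos_refl_trans_1n psymbol simple_expansion.

Definition ptree (x : psymbol) : tree := sg_src (ps_val x).

Lemma reach_trans x y z : reach x y -> reach y z -> reach x z.
Proof. by elim=> // a b c ab bc IH /IH; apply: rt1n_trans. Qed.

Lemma reach1 n (i : 'I_n.+1) (x : S n) : reach (PSymbol x) (PSymbol (sg_expand i x)).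
Proof. by apply: rt1n_trans (rt1n_refl _ _ _); exists i. Qed.

Lemma leaves_ptree x : leaves (ptree x) = (ps_level x).+1.
Proof. exact/eqP/ntreeP. Qed.

Lemma reach_equiv x y : reach x y -> equivalent x y.
Proof.
elim=> [a|a b c ab _ IH]; first exact: rst_refl.
by apply: rst_trans IH; apply: rst_step.
Qed.

Lemma reach_tsub x y : reach x y -> tsub (ptree x) (ptree y).
Proof.
elim=> [a|a b c [i ->] _ IH]; first exact: tsub_refl.
apply: tsub_trans IH.
by rewrite {2}/ptree /= sg_src_expand; apply: tsub_expand.
Qed.

Lemma reach_ex x u : tsub (ptree x) u -> exists2 y, reach x y & ptree y = u.
Proof.
have [m] := ubnP (leaves u - leaves (ptree x)).
elim: m x => // m IH x mle /[dup] xu /tsub_step[xu'|[i ix iu]].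
  by exists x => //; apply: rt1n_refl.
rewrite leaves_ptree in ix.
pose y := PSymbol (sg_expand (Ordinal ix) (ps_val x)).
have yt : ptree y = expand_tree i (ptree x) by rewrite /ptree sg_src_expand.
have [||z yz zu] := IH y.
- rewrite yt leaves_expand; move: (tsub_leaves iu); rewrite leaves_expand => lt.
  by rewrite -ltnS (leq_trans _ mle) // ltnS ltn_sub2l.
- by rewrite yt.
by exists z => //; apply: rt1n_trans yz; exists (Ordinal ix).
Qed.


Lemma reach_case x y : reach x y -> x = y \/
  exists i : 'I_(ps_level x).+1, reach (PSymbol (sg_expand i (ps_val x))) y.
Proof. by case=> [|a b [i ->] ab]; [left | right; exists i]. Qed.

Lemma reach_strict x i y :
  reach (PSymbol (@sg_expand S (ps_level x) i (ps_val x))) y ->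
  (leaves (ptree x) < leaves (ptree y))%N.
Proof.
move/reach_tsub/tsub_leaves; apply: leq_trans.
by rewrite /ptree /= sg_src_expand leaves_expand.
Qed.


Lemma reach_uniq x y z : reach x y -> reach x z -> ptree y = ptree z -> y = z.
Proof.
have [m] := ubnP (leaves (ptree y) - leaves (ptree x)).
elim: m x y z => // m IH x y z mle xy xz eq.
case: (reach_case xy) => [xy'|[i iy]].
  case: (reach_case xz) => [xz'|[j jz]]; first by rewrite -xy' -xz'.
  by have := reach_strict jz; rewrite -eq -xy' ltnn.
case: (reach_case xz) => [xz'|[j jz]].
  by have := reach_strict iy; rewrite eq -xz' ltnn.
have lt := reach_strict iy.
have {}IH k u v : ptree u = ptree y ->
    reach (PSymbol (@sg_expand S (ps_level x) k (ps_val x))) u ->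
    reach (PSymbol (@sg_expand S (ps_level x) k (ps_val x))) v ->
    ptree u = ptree v -> u = v.
  move=> uy; apply: IH.
  rewrite uy {2}/ptree sg_src_expand leaves_expand -/(ptree x).
  by rewrite -ltnS (leq_trans _ mle) // ltnS ltn_sub2l.
have key (a b : 'I_(ps_level x).+1) u v : (b < a)%N ->
    ptree u = ptree y -> ptree v = ptree y ->
    reach (PSymbol (sg_expand a (ps_val x))) u ->
    reach (PSymbol (sg_expand b (ps_val x))) v -> u = v.
  move=> ba uy vy au bv.
  have [|w jw wy] :=
    @reach_ex (PSymbol (sg_expand (same b) (sg_expand a (ps_val x)))) (ptree y).
    rewrite /ptree !sg_src_expand /= -/(ptree y).
    have := reach_tsub au; rewrite uy {1}/ptree sg_src_expand => ay.
    have := reach_tsub bv; rewrite vy {1}/ptree sg_src_expand => bY.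
    by apply: tsub_expand2 => //; rewrite (eqP (ntreeP _)).
  transitivity w; first apply: (IH a) => //.
  - by apply: reach_trans jw; apply: reach1.
  - by rewrite uy wy.
  apply/esym/(IH b) => //; last by rewrite vy wy.
  by apply: reach_trans jw; rewrite sg_expand_comm //; apply: reach1.
case: (ltngtP i j) => ij.
- by apply/esym/(key j i).
- by apply: (key i j).
- by move/val_inj: ij jz => <- jz; apply: (IH i).
Qed.

Lemma equiv_reach x y : equivalent x y -> exists2 z, reach x z & reach y z.
Proof.
elim=> {x y} [x y xy|x|x y _ [z]|x y z _ [u xu yu] _ [v yv zv]].
- exists y; last exact: rt1n_refl.
  by apply: rt1n_trans xy _; apply: rt1n_refl.
- by exists x; apply: rt1n_refl.
- by exists z.
have [u' uu' eu] := reach_ex (tsub_joinl (ptree u) (ptree v)).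
have [v' vv' ev] := reach_ex (tsub_joinr (ptree u) (ptree v)).
have e : u' = v'.
  apply: (@reach_uniq y); last by rewrite eu ev.
    exact: reach_trans uu'.
  exact: reach_trans vv'.
by exists u'; [apply: reach_trans uu' | rewrite e; apply: reach_trans vv'].
Qed.

Lemma reach_class x y : reach x y -> psclass x = psclass y.
Proof. by move=> xy; apply/psclass_eq/reach_equiv. Qed.

Lemma reach_of x T : tsub (ptree x) (T : tree) ->
  forall n (H : leaves T == n.+1),
  exists2 y : S n, reach x (PSymbol y) & sg_src y = NTree H.
Proof.
move=> xT n H; have [[m y] xy yT] := reach_ex xT.
have e : m = n.
  by have := leaves_ptree (PSymbol y); rewrite yT (eqP H) => -[].
by subst m; exists y => //; apply: ntree_inj.
Qed.

Lemma inv_expand n (i : 'I_n.+1) (x : S n) :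
  sg_expand (sg_act x i) (sg_inv x) = sg_inv (sg_expand i x).
Proof.
have e : sg_mul (sg_expand (sg_act x i) (sg_inv x)) (sg_expand i x)
         = sg_one (sg_src (sg_expand i x)).
  by rewrite -sg_expandM ?sg_src_inv // sg_mulVg sg_expand1 sg_src_expand.
have tg : sg_src (sg_expand (sg_act x i) (sg_inv x)) = sg_tgt (sg_expand i x).
  by rewrite sg_src_expand sg_src_inv sg_tgt_expand.
have := congr1 (fun z => sg_mul z (sg_inv (sg_expand i x))) e.
by rewrite -sg_mulA sg_mulgV -tg sg_mulg1 -sg_tgt_inv sg_mul1g.
Qed.

Lemma reach_inv x y : reach x y ->
  reach (PSymbol (sg_inv (ps_val x))) (PSymbol (sg_inv (ps_val y))).
Proof.
elim=> [a|a b c [i ->] _ IH]; first exact: rt1n_refl.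
by apply: reach_trans IH; rewrite -inv_expand; apply: reach1.
Qed.

Lemma psymbol_inj n (x y : S n) : PSymbol x = PSymbol y -> x = y.
Proof.
move=> /(congr1 (fun p : psymbol => existT S (ps_level p) (ps_val p))) /=.
exact: (Eqdep_dec.inj_pair2_eq_dec _ PeanoNat.Nat.eq_dec).
Qed.

Lemma reach_mul n (x y : S n) m (x' y' : S m) :
  sg_src x = sg_tgt y -> sg_src x' = sg_tgt y' ->
  reach (PSymbol x) (PSymbol x') -> reach (PSymbol y) (PSymbol y') ->
  reach (PSymbol (sg_mul x y)) (PSymbol (sg_mul x' y')).
Proof.
move=> xy xy' rx ry.
suff gen py py' : reach py py' -> forall (a : S (ps_level py))
    (a' : S (ps_level py')), sg_src a = sg_tgt (ps_val py) ->
    sg_src a' = sg_tgt (ps_val py') -> reach (PSymbol a) (PSymbol a') ->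
    reach (PSymbol (sg_mul a (ps_val py))) (PSymbol (sg_mul a' (ps_val py'))).
  exact: (gen _ _ ry x x').
elim=> {n x y m x' y' xy xy' rx ry py py'} [y|y y1 y' [i ->] yy' IH] x x' xy xy' rx.
  have /psymbol_inj -> : PSymbol x = PSymbol x'.
    by apply: reach_uniq rx _; [apply: rt1n_refl | rewrite /ptree /= xy xy'].
  exact: rt1n_refl.
have x1y : sg_src (sg_expand (sg_act (ps_val y) i) x)
    = sg_tgt (sg_expand i (ps_val y)) by rewrite sg_src_expand sg_tgt_expand xy.
apply: reach_trans (IH _ _ x1y xy' _).
  by rewrite /= -sg_expandM //; apply: reach1.
have [|z z1 zx] := @reach_ex (PSymbol (sg_expand (sg_act (ps_val y) i) x))
    (ptree (PSymbol x')).
  rewrite /ptree /= x1y xy' -!sg_src_inv.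
  exact: (reach_tsub (reach_inv yy')).
suff <- : z = PSymbol x' by [].
by apply: (@reach_uniq (PSymbol x)) => //; apply: reach_trans z1; apply: reach1.
Qed.

Lemma mul_classP (a b : classes) : exists n (x y : S n),
  [/\ sg_src x = sg_tgt y, a = class_of x & b = class_of y].
Proof.
have [n [x ->]] := class_ofP a; have [m [y ->]] := class_ofP b.
pose T := tjoin (sg_src x) (sg_tgt y).
have H : leaves T == (leaves T).-1.+1 by rewrite prednK ?leaves_gt0.
have [x' rx sx] := @reach_of (PSymbol x) T (tsub_joinl _ _) _ H.
have [|y' ry sy] := @reach_of (PSymbol (sg_inv y)) T _ _ H.
  by rewrite /ptree /= sg_src_inv tsub_joinr.
exists _, x', (sg_inv y'); split; first by rewrite sg_tgt_inv sx sy.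
  exact: reach_class.
by apply: reach_class; have := reach_inv ry; rewrite /= sg_invK.
Qed.

(* Both symbols are first replaced by equivalent ones with a common middle
   tree; by [class_ofM] the result does not depend on this choice. *)
Lemma mul_class_ex (a b : classes) : exists c : classes,
  exists n (x y : S n),
  [/\ sg_src x = sg_tgt y, a = class_of x, b = class_of y
    & c = class_of (sg_mul x y)].
Proof.
have [n [x [y [xy ax bY]]]] := mul_classP a b.
by exists (class_of (sg_mul x y)), n, x, y.
Qed.

Definition mul_class (a b : classes) : classes := projT1 (cid (mul_class_ex a b)).

Definition one_class : classes := class_of (sg_one root_tree).

Definition inv_psymbol (x : psymbol) : psymbol := PSymbol (sg_inv (ps_val x)).

Definition inv_class (a : classes) : classes :=
  psclass (inv_psymbol (repr a)%qT).

Lemma mul_class_of n (x y : S n) : sg_src x = sg_tgt y ->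
  mul_class (class_of x) (class_of y) = class_of (sg_mul x y).
Proof.
rewrite /mul_class => xy; case: cid => c /= [m [x' [y' [xy' ex ey ->]]]].
have /psclass_eq/equiv_reach[[k u] xu xu'] := ex.
have /psclass_eq/equiv_reach[[l v] yv yv'] := ey.
pose T := tjoin (sg_src u) (sg_tgt v).
have H : leaves T == (leaves T).-1.+1 by rewrite prednK ?leaves_gt0.
have [x2 rx sx] := @reach_of (PSymbol u) T (tsub_joinl _ _) _ H.
have [|y2 ry sy] := @reach_of (PSymbol (sg_inv v)) T _ _ H.
  by rewrite /ptree /= sg_src_inv tsub_joinr.
have {}ry : reach (PSymbol v) (PSymbol (sg_inv y2)).
  by have := reach_inv ry; rewrite /= sg_invK.
have e2 : sg_src x2 = sg_tgt (sg_inv y2) by rewrite sg_tgt_inv sx sy.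
transitivity (class_of (sg_mul x2 (sg_inv y2))).
  by apply/reach_class/reach_mul => //; [apply: reach_trans rx | apply: reach_trans ry].
apply/esym/reach_class/reach_mul => //.
  by apply: reach_trans rx.
by apply: reach_trans ry.
Qed.

Lemma inv_class_of n (x : S n) : inv_class (class_of x) = class_of (sg_inv x).
Proof.
rewrite /inv_class.
have /psclass_eq/equiv_reach[z xz yz] :
  psclass (repr (class_of x))%qT = psclass (PSymbol x) by exact: reprK.
by rewrite (reach_class (reach_inv xz)) -(reach_class (reach_inv yz)).
Qed.

Lemma reach_one x y : reach x y -> ps_val x = sg_one (sg_src (ps_val x)) ->
  ps_val y = sg_one (sg_src (ps_val y)).
Proof.
elim=> // a b c [i ->] _ IH aE; apply: IH => /=.
by rewrite aE sg_expand1 sg_src_one.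
Qed.

Lemma one_class_of n (t : ntree n) : class_of (sg_one t) = one_class.
Proof.
have [|x rx sx] := @reach_of (PSymbol (sg_one root_tree)) t _ _ (ntreeP t).
  by rewrite /ptree /= sg_src_one.
have -> : sg_one t = x.
  have := reach_one rx; rewrite /= sg_src_one sx => -> //.
  by congr sg_one; apply: ntree_inj.
exact/esym/reach_class.
Qed.

Lemma common_class (a b c : classes) : exists n (x y z : S n),
  [/\ sg_src x = sg_tgt y, sg_src y = sg_tgt z, a = class_of x,
      b = class_of y & c = class_of z].
Proof.
have [n [x [y [xy -> ->]]]] := mul_classP a b; have [m [z ->]] := class_ofP c.
pose T := tjoin (sg_src y) (sg_tgt z).
have H : leaves T == (leaves T).-1.+1 by rewrite prednK ?leaves_gt0.
have [y' ry sy] := @reach_of (PSymbol y) T (tsub_joinl _ _) _ H.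
have [|z' rz sz] := @reach_of (PSymbol (sg_inv z)) T _ _ H.
  by rewrite /ptree /= sg_src_inv tsub_joinr.
have {}rz : reach (PSymbol z) (PSymbol (sg_inv z')).
  by have := reach_inv rz; rewrite /= sg_invK.
have [|x' rx sx] := @reach_of (PSymbol x) (sg_tgt y') _ _ (ntreeP _).
  have := reach_tsub (reach_inv ry).
  by rewrite /ptree /= !sg_src_inv xy.
exists _, x', y', (sg_inv z'); split; last 1 first.
- exact: reach_class.
- by rewrite sx; apply: ntree_inj.
- by rewrite sg_tgt_inv sy sz.
- exact: reach_class.
- exact: reach_class.
Qed.

Lemma mul_classA : associative mul_class.
Proof.
move=> a b c; have [n [x [y [z [xy yz -> -> ->]]]]] := common_class a b c.
rewrite !mul_class_of ?sg_mulA //; first by rewrite sg_src_mul.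
by rewrite sg_tgt_mul.
Qed.

Lemma mul_class1g : left_id one_class mul_class.
Proof.
move=> a; have [n [x ->]] := class_ofP a.
by rewrite -(one_class_of (sg_tgt x)) mul_class_of ?sg_src_one // sg_mul1g.
Qed.

Lemma mul_classg1 : right_id one_class mul_class.
Proof.
move=> a; have [n [x ->]] := class_ofP a.
by rewrite -(one_class_of (sg_src x)) mul_class_of ?sg_tgt_one // sg_mulg1.
Qed.

Lemma mul_classVg : left_inverse one_class inv_class mul_class.
Proof.
move=> a; have [n [x ->]] := class_ofP a.
by rewrite inv_class_of mul_class_of ?sg_src_inv // sg_mulVg one_class_of.
Qed.

Lemma mul_classgV : right_inverse one_class inv_class mul_class.
Proof.
move=> a; have [n [x ->]] := class_ofP a.
by rewrite inv_class_of mul_class_of ?sg_tgt_inv // sg_mulgV one_class_of.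
Qed.

HB.instance Definition _ := isGroup.Build classes
  mul_classA mul_class1g mul_classg1 mul_classVg mul_classgV.

Lemma class_ofM n (x y : S n) : sg_src x = sg_tgt y ->
  class_of x * class_of y = class_of (sg_mul x y).
Proof. exact: mul_class_of. Qed.

Lemma class_ofV n (x : S n) : (class_of x)^-1 = class_of (sg_inv x).
Proof. exact: inv_class_of. Qed.

Lemma class_of1 n (t : ntree n) : class_of (sg_one t) = 1.
Proof. exact: one_class_of. Qed.

Lemma class_of_expand n (i : 'I_n.+1) (x : S n) :
  class_of (sg_expand i x) = class_of x.
Proof. by apply/esym/reach_class/reach1. Qed.

End Classes.

Arguments class_of {S n} x.

Lemma expand_comm n (i j : 'I_n.+1) (t : ntree n) : (j < i)%N ->
  expand (same j) (expand i t) = expand (next i) (expand j t).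
Proof.
by move=> ji; apply: ntree_inj; apply: expand_tree_comm => //; rewrite (eqP (ntreeP t)).
Qed.

Lemma val_double n (i : 'I_n.+1) (s : sym n.+1) (k : 'I_n.+1) (k' : 'I_n.+2) :
  k' = bump i.+1 k :> nat ->
  sym_app (double i s) k' = bump (sym_app s i).+1 (sym_app s k) :> nat.
Proof.
move=> kk; have -> : k' = lift (next i) k by apply: val_inj.
by rewrite /sym_app /double lift_perm_lift.
Qed.

Lemma double_same n (i j : 'I_n.+1) (s : sym n.+1) : (j < i)%N ->
  sym_app (double i s) (same j) = bump (sym_app s i).+1 (sym_app s j) :> nat.
Proof. by move=> ji; apply: val_double; rewrite /= /bump ltnNge (ltnW ji). Qed.

Lemma double_next n (i j : 'I_n.+1) (s : sym n.+1) : (j < i)%N ->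
  sym_app (double j s) (next i) = bump (sym_app s j).+1 (sym_app s i) :> nat.
Proof. by move=> ji; apply: val_double; rewrite /= /bump ji. Qed.

Lemma expand_double n (i j : 'I_n.+1) (s : sym n.+1) (t : ntree n) : (j < i)%N ->
  expand (sym_app (double i s) (same j)) (expand (sym_app s i) t)
  = expand (sym_app (double j s) (next i)) (expand (sym_app s j) t).
Proof.
move=> ji; have := double_same s ji; have := double_next s ji.
move: (sym_app (double i s) _) (sym_app (double j s) _) => x y.
have : sym_app s i != sym_app s j.
  by rewrite (can_eq (sym_appK s)) -val_eqE /= gtn_eqF.
move: (sym_app s i) (sym_app s j) => a b; rewrite -val_eqE /= /bump.
case: ltngtP => // ab _ ye xe.
- have -> : x = same b by apply: val_inj.
  have -> : y = next a by apply: val_inj.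
  by rewrite expand_comm.
- have -> : x = next b by apply: val_inj.
  have -> : y = same a by apply: val_inj.
  by rewrite expand_comm.
Qed.

#[local] Obligation Tactic := idtac.

Section Groups.
Variable E : cosimplicial_ext.

Definition ksymbol n : Type := (ntree n * ce_K E n)%type.

Program Definition ksymbols : symbols := {|
  sg_car := ksymbol;
  sg_src n x := x.1;
  sg_tgt n x := x.1;
  sg_act n x i := i;
  sg_mul n x y := (x.1, x.2 * y.2);
  sg_one n t := (t, 1);
  sg_inv n x := (x.1, x.2^-1);
  sg_expand n i x := (expand i x.1, ce_doubleK i x.2)
|}.
Next Obligation. by []. Qed.
Next Obligation. by []. Qed.
Next Obligation. by []. Qed.
Next Obligation. by []. Qed.
Next Obligation. by []. Qed.
Next Obligation. by []. Qed.
Next Obligation. by move=> n x y z /=; rewrite mulgA. Qed.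
Next Obligation. by move=> n [t k] /=; rewrite mul1g. Qed.
Next Obligation. by move=> n [t k] /=; rewrite mulg1. Qed.
Next Obligation. by move=> n [t k] /=; rewrite mulVg. Qed.
Next Obligation. by move=> n [t k] /=; rewrite mulgV. Qed.
Next Obligation. by []. Qed.
Next Obligation. by []. Qed.
Next Obligation. by []. Qed.
Next Obligation. by []. Qed.
Next Obligation. by move=> n i x y /= _; rewrite gmulfM. Qed.
Next Obligation. by move=> n i t /=; rewrite mult1. Qed.
Next Obligation.
by move=> n i j [t k] /= ji; rewrite expand_comm // ce_doubleK_doubleK // ltnW.
Qed.

(* The colimit of the groups K(tau), the class of (tau, k) being the image of k.
   Every expansion is a composite of simple ones, hence the simple expansions
   generate the equivalence relation that defines the colimit. *)
Definition Kinf : groupType := classes ksymbols.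

Definition Kclass n (t : ntree n) (k : ce_K E n) : Kinf :=
  class_of ((t, k) : ksymbols n).

Lemma KclassM n (t : ntree n) (k k' : ce_K E n) :
  Kclass t k * Kclass t k' = Kclass t (k * k').
Proof. exact: class_ofM. Qed.

Record gsymbol (n : nat) := GSymbol {
  gs_tgt : ntree n;
  gs_src : ntree n;
  gs_elt : ce_G E n
}.

Lemma ce_double1 n (i : 'I_n.+1) : ce_double i (1 : ce_G E n) = 1.
Proof.
have := ce_doubleM i (1 : ce_G E n) 1.
rewrite mult1 sym_app1 mulg1 => /(congr1 (fun x => x / ce_double i 1)).
by rewrite mulgK mulgV => ->.
Qed.

Program Definition gsymbols : symbols := {|
  sg_car := gsymbol;
  sg_src n x := gs_src x;
  sg_tgt n x := gs_tgt x;
  sg_act n x i := sym_app (ce_bar E n (gs_elt x)) i;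
  sg_mul n x y := GSymbol (gs_tgt x) (gs_src y) (gs_elt x * gs_elt y);
  sg_one n t := GSymbol t t 1;
  sg_inv n x := GSymbol (gs_src x) (gs_tgt x) (gs_elt x)^-1;
  sg_expand n i x :=
    GSymbol (expand (sym_app (ce_bar E n (gs_elt x)) i) (gs_tgt x))
            (expand i (gs_src x)) (ce_double i (gs_elt x))
|}.
Next Obligation. by []. Qed.
Next Obligation. by []. Qed.
Next Obligation. by []. Qed.
Next Obligation. by []. Qed.
Next Obligation. by []. Qed.
Next Obligation. by []. Qed.
Next Obligation. by move=> n x y z /=; rewrite mulgA. Qed.
Next Obligation. by move=> n [a b g] /=; rewrite mul1g. Qed.
Next Obligation. by move=> n [a b g] /=; rewrite mulg1. Qed.
Next Obligation. by move=> n [a b g] /=; rewrite mulVg. Qed.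
Next Obligation. by move=> n [a b g] /=; rewrite mulgV. Qed.
Next Obligation. by move=> n x i /=; rewrite multV sym_appK. Qed.
Next Obligation. by move=> n x i /=; rewrite multV sym_appKV. Qed.
Next Obligation. by []. Qed.
Next Obligation. by []. Qed.
Next Obligation.
by move=> n i x y /= _; rewrite gmulfM sym_mulE ce_doubleM.
Qed.
Next Obligation. by move=> n i t /=; rewrite mult1 sym_app1 ce_double1. Qed.
Next Obligation.
move=> n i j x ji /=.
by rewrite ce_double_comm // expand_comm // !ce_bar_double expand_double.
Qed.

Definition GV : groupType := classes gsymbols.

Definition Gclass n (t1 t0 : ntree n) (g : ce_G E n) : GV :=
  class_of (GSymbol t1 t0 g : gsymbols n).

Lemma GclassM n (t2 t1 t0 : ntree n) (g h : ce_G E n) :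
  Gclass t2 t1 g * Gclass t1 t0 h = Gclass t2 t0 (g * h).
Proof. exact: class_ofM. Qed.

End Groups.

Arguments GSymbol {E n}.

Lemma Gclass_expand E n (i : 'I_n.+1) (t1 t0 : ntree n) (g : ce_G E n) :
  Gclass (expand (sym_app (ce_bar E n g) i) t1) (expand i t0) (ce_double i g)
  = Gclass t1 t0 g.
Proof. exact: (class_of_expand i (GSymbol t1 t0 g : gsymbols E n)). Qed.

Lemma Kclass_expand E n (i : 'I_n.+1) (t : ntree n) (k : ce_K E n) :
  Kclass (expand i t) (ce_doubleK i k) = Kclass t k.
Proof. exact: (class_of_expand i ((t, k) : ksymbols E n)). Qed.

Record symbols_hom (S S' : symbols) := SymbolsHom {
  sh_fun : forall n, S n -> S' n;
  sh_src : forall n (x : S n), sg_src (sh_fun x) = sg_src x;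
  sh_tgt : forall n (x : S n), sg_tgt (sh_fun x) = sg_tgt x;
  sh_mul : forall n (x y : S n), sg_src x = sg_tgt y ->
    sh_fun (sg_mul x y) = sg_mul (sh_fun x) (sh_fun y);
  sh_expand : forall n (i : 'I_n.+1) (x : S n),
    sh_fun (sg_expand i x) = sg_expand i (sh_fun x)
}.

Arguments sh_fun {S S'} s {n} x.

Section ClassesMap.
Variables (S S' : symbols) (f : symbols_hom S S').

Definition classes_map (a : classes S) : classes S' :=
  let x := (repr a)%qT in class_of (sh_fun f (ps_val x)).

Lemma reach_hom x y : reach x y ->
  reach (PSymbol (sh_fun f (ps_val x))) (PSymbol (sh_fun f (ps_val y))).
Proof.
elim=> [a|a b c [i ->] _ IH]; first exact: rt1n_refl.
by apply: reach_trans IH; rewrite /= sh_expand; apply: reach1.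
Qed.

Lemma classes_map_of n (x : S n) : classes_map (class_of x) = class_of (sh_fun f x).
Proof.
rewrite /classes_map.
have /psclass_eq/equiv_reach[z xz yz] :
  psclass (repr (class_of x))%qT = psclass (PSymbol x) by exact: reprK.
by rewrite /class_of (reach_class (reach_hom xz)) -(reach_class (reach_hom yz)).
Qed.

Fact classes_mapM : {morph classes_map : a b / a * b}.
Proof.
move=> a b; have [n [x [y [xy -> ->]]]] := mul_classP a b.
by rewrite class_ofM // !classes_map_of sh_mul // class_ofM // sh_src sh_tgt.
Qed.

HB.instance Definition _ :=
  isMultiplicative.Build (classes S) (classes S') classes_map classes_mapM.

End ClassesMap.

Definition triv_group : Type := unit.
HB.instance Definition _ := Choice.copy triv_group unit.
Section Triv.
Let mul (x y : triv_group) : triv_group := tt.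
Let inv (x : triv_group) : triv_group := tt.
Lemma triv_mulA : associative mul. Proof. by []. Qed.
Lemma triv_mul1g : left_id tt mul. Proof. by case. Qed.
Lemma triv_mulg1 : right_id tt mul. Proof. by case. Qed.
Lemma triv_mulVg : left_inverse tt inv mul. Proof. by []. Qed.
Lemma triv_mulgV : right_inverse tt inv mul. Proof. by []. Qed.
HB.instance Definition _ := isGroup.Build triv_group
  triv_mulA triv_mul1g triv_mulg1 triv_mulVg triv_mulgV.
End Triv.

Fact sym_ext_exact n : @short_exact triv_group (sym n.+1) (sym n.+1)
  (@one_fun triv_group (sym n.+1)) idfun.
Proof.
split=> [[] [] //|g|q]; last by exists q.
by split=> [/= ->|[k <-]] //; exists tt.
Qed.

Lemma doubleM n (i : 'I_n.+1) (g h : sym n.+1) :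
  double i (g * h) = double (sym_app h i) g * double i h.
Proof.
rewrite /double sym_mulE.
exact: (esym (lift_permM _ _ _ (h : 'S_n.+1) (g : 'S_n.+1))).
Qed.

Lemma double_new n (i : 'I_n.+1) (s : sym n.+1) (k : 'I_n.+2) :
  k = i.+1 :> nat -> sym_app (double i s) k = (sym_app s i).+1 :> nat.
Proof.
move=> ki; have -> : k = next i by apply: val_inj.
by rewrite /sym_app /double lift_perm_id.
Qed.

Lemma double_comm n (i j : 'I_n.+1) (s : sym n.+1) : (j < i)%N ->
  double (same j) (double i s) = double (next i) (double j s).
Proof.
move=> ji; apply/permP => k; apply: val_inj.
rewrite -!/(sym_app _ k) /=.
have di := double_same s ji; have dj := double_next s ji.
have ne : sym_app s i <> sym_app s j :> nat.
  by move/val_inj/(can_inj (sym_appK s)) => e; rewrite e ltnn in ji.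
case: (unliftP (next (same j)) k) => [k1|] ek; last first.
  have e1 : k = j.+1 :> nat by rewrite ek.
  have e2 : k = bump (next i).+1 (next j) :> nat by rewrite e1 /= /bump; lia.
  rewrite (double_new (i := same j) _ e1) (val_double _ e2) di dj.
  by rewrite (@double_new _ j s (next j)) // /bump; lia.
have e1 : k = bump (same j).+1 k1 :> nat by rewrite ek.
rewrite (val_double (i := same j) _ e1) di.
case: (unliftP (next i) k1) => [k2|] ek1.
  have e2 : k1 = bump i.+1 k2 :> nat by rewrite ek1.
  have e3 : lift (next j) k2 = bump j.+1 k2 :> nat by [].
  have e4 : k = bump (next i).+1 (lift (next j) k2) :> nat.
    by rewrite e1 e2 e3 /= /bump; lia.
  by rewrite (val_double _ e2) (val_double _ e4) dj (val_double _ e3) /bump; lia.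
have e2 : k1 = i.+1 :> nat by rewrite ek1.
have e3 : k = (next i).+1 :> nat by rewrite e1 e2 /= /bump; lia.
by rewrite (double_new _ e2) (double_new _ e3) dj /bump; lia.
Qed.

Program Definition sym_ext : cosimplicial_ext := {|
  ce_K _ := triv_group;
  ce_G n := sym n.+1;
  ce_iota n := one_fun (sym n.+1);
  ce_bar n := idfun;
  ce_exact := sym_ext_exact;
  ce_double n i s := double i s;
  ce_doubleK n i := idfun;
  ce_codegen n i := idfun
|}.
Next Obligation. by []. Qed.
Next Obligation. by move=> n i g h; exact: doubleM. Qed.
Next Obligation. by move=> n i j g; exact: double_comm. Qed.
Next Obligation.
by move=> n i k /=; rewrite /double sym_app1; apply/esym/lift_perm1.
Qed.
Next Obligation. by []. Qed.
Next Obligation. by []. Qed.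
Next Obligation. by []. Qed.
Next Obligation. by []. Qed.
Next Obligation. by []. Qed.
Next Obligation. by []. Qed.

Definition V : groupType := GV sym_ext.

Definition Vclass n (t1 t0 : ntree n) (s : sym n.+1) : V :=
  Gclass (E := sym_ext) t1 t0 s.

Definition in_F : {pred V} :=
  fun x => `[< exists n (t1 t0 : ntree n), x = Vclass t1 t0 1 >].

Lemma reach_sym1 (x y : psymbol (gsymbols sym_ext)) :
  reach x y -> gs_elt (ps_val x) = 1 -> gs_elt (ps_val y) = 1.
Proof.
elim=> // a b c [i ->] _ IH e1; apply: IH => /=.
by rewrite e1; apply: (@ce_double1 sym_ext).
Qed.

Fact F_closed : group_closed in_F.
Proof.
split=> [|x y].
  by apply/asboolP; exists 0%N, root_tree, root_tree.
move=> /asboolP[n [t1 [t0 ->]]] /asboolP[m [u1 [u0 ->]]]; apply/asboolP.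
pose S := gsymbols sym_ext.
pose p : psymbol S := PSymbol (GSymbol t1 t0 1 : S n).
pose q : psymbol S := PSymbol (GSymbol u1 u0 1 : S m).
pose T := tjoin t0 u0.
have H : leaves T == (leaves T).-1.+1 by rewrite prednK ?leaves_gt0.
have [[a1 a0 g] pa /= a0T] := @reach_of S p T (tsub_joinl _ _) _ H.
have [[b1 b0 h] qb /= b0T] := @reach_of S q T (tsub_joinr _ _) _ H.
have /= g1 := reach_sym1 pa erefl; have /= h1 := reach_sym1 qb erefl.
exists _, a1, b1.
have -> : Vclass t1 t0 1 = class_of (GSymbol a1 a0 g : S _) := reach_class pa.
have -> : Vclass u1 u0 1 = class_of (GSymbol b1 b0 h : S _) := reach_class qb.
rewrite class_ofV class_ofM /=; last by rewrite a0T b0T.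
by rewrite g1 h1 invg1 mulg1.
Qed.

Definition F : Type := {x : V | in_F x}.
HB.instance Definition _ := SubChoice.on F.
HB.instance Definition _ := SubChoice_isSubGroup.Build V in_F F F_closed.

Section Sequence.
Variable E : cosimplicial_ext.

Program Definition ksymbols_gsymbols :
    symbols_hom (ksymbols E) (gsymbols E) := {|
  sh_fun n x := GSymbol x.1 x.1 (ce_iota E n x.2)
|}.
Next Obligation. by []. Qed.
Next Obligation. by []. Qed.
Next Obligation. by move=> n [t k] [u l] /= ->; rewrite gmulfM. Qed.
Next Obligation.
move=> n i [t k] /=; rewrite ce_iota_double.
suff -> : ce_bar E n (ce_iota E n k) = 1 by rewrite sym_app1.
by have [_ ker _] := ce_exact E n; apply/ker; exists k.
Qed.

Definition Kinf_GV : {multiplicative Kinf E -> GV E} :=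
  classes_map ksymbols_gsymbols.

Lemma Kinf_GVE n (t : ntree n) (k : ce_K E n) :
  Kinf_GV (Kclass t k) = Gclass t t (ce_iota E n k).
Proof. exact: (classes_map_of ksymbols_gsymbols). Qed.

Program Definition gsymbols_sym :
    symbols_hom (gsymbols E) (gsymbols sym_ext) := {|
  sh_fun n x := @GSymbol sym_ext n (gs_tgt x) (gs_src x) (ce_bar E n (gs_elt x))
|}.
Next Obligation. by []. Qed.
Next Obligation. by []. Qed.
Next Obligation. by move=> n x y /= _; rewrite gmulfM. Qed.
Next Obligation. by move=> n i x /=; rewrite ce_bar_double. Qed.

Definition GV_V : {multiplicative GV E -> V} := classes_map gsymbols_sym.

Lemma GV_VE n (t1 t0 : ntree n) (g : ce_G E n) :
  GV_V (Gclass t1 t0 g) = Vclass t1 t0 (ce_bar E n g).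
Proof. exact: (classes_map_of gsymbols_sym). Qed.

End Sequence.

Definition split_over_F (G : groupType) (p : {multiplicative G -> V}) : Prop :=
  exists s : {multiplicative F -> G}, forall x : F, p (s x) = val x.

Record category := Category {
  ob :> Type;
  hom : ob -> ob -> Type;
  idc : forall A, hom A A;
  compc : forall A B C, hom B C -> hom A B -> hom A C;
  compc1 : forall A B (f : hom A B), compc f (idc A) = f;
  comp1c : forall A B (f : hom A B), compc (idc B) f = f;
  compcA : forall A B C D (f : hom C D) (g : hom B C) (h : hom A B),
    compc f (compc g h) = compc (compc f g) h
}.

(* The functors whose action on objects is Fob. *)
Record functor_on (C D : category) (Fob : C -> D) := FunctorOn {
  fmap : forall A B : C, hom A B -> hom (Fob A) (Fob B);
  fmap_id : forall A, fmap (idc A) = idc (Fob A);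
  fmap_comp : forall A B C (f : hom B C) (g : hom A B),
    fmap (compc f g) = compc (fmap f) (fmap g)
}.

Lemma mult_eq (G H : groupType) (f g : {multiplicative G -> H}) :
  f =1 g -> f = g.
Proof.
case: f g => [f [[fM]]] [g [[gM]]] /= /funext fg.
by subst g; rewrite (Prop_irrelevance fM gM).
Qed.

Definition mult_comp (G H L : groupType) (f : {multiplicative H -> L})
  (g : {multiplicative G -> H}) : {multiplicative G -> L} := f \o g.

Definition mult_id (G : groupType) : {multiplicative G -> G} := idfun.

Program Definition Grp : category := {|
  ob := groupType;
  hom G H := {multiplicative G -> H};
  idc := mult_id;
  compc := mult_comp
|}.
Next Obligation. by move=> *; apply: mult_eq. Qed.
Next Obligation. by move=> *; apply: mult_eq. Qed.
Next Obligation. by move=> *; apply: mult_eq. Qed.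

Lemma cosimplicial_hom_eq (E E' : cosimplicial_ext) (f g : cosimplicial_hom E E') :
  (forall n, ch_K f n =1 ch_K g n) -> (forall n, ch_G f n =1 ch_G g n) -> f = g.
Proof.
case: f g => [fK fG f1 f2 f3 f4] [gK gG g1 g2 g3 g4] /= eK eG.
have ? : fK = gK by apply: functional_extensionality_dep => n; apply/mult_eq/(eK n).
have ? : fG = gG by apply: functional_extensionality_dep => n; apply/mult_eq/(eG n).
by subst gK gG; congr CosimplicialHom; apply: Prop_irrelevance.
Qed.

Program Definition cosimplicial_id (E : cosimplicial_ext) :
    cosimplicial_hom E E := {|
  ch_K n := mult_id (ce_K E n);
  ch_G n := mult_id (ce_G E n)
|}.
Next Obligation. by []. Qed.
Next Obligation. by []. Qed.
Next Obligation. by []. Qed.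
Next Obligation. by []. Qed.

Program Definition cosimplicial_comp (E1 E2 E3 : cosimplicial_ext)
    (f : cosimplicial_hom E2 E3) (g : cosimplicial_hom E1 E2) :
    cosimplicial_hom E1 E3 := {|
  ch_K n := mult_comp (ch_K f n) (ch_K g n);
  ch_G n := mult_comp (ch_G f n) (ch_G g n)
|}.
Next Obligation. by move=> * /=; rewrite !ch_iota. Qed.
Next Obligation. by move=> * /=; rewrite !ch_bar. Qed.
Next Obligation. by move=> * /=; rewrite !ch_double. Qed.
Next Obligation. by move=> * /=; rewrite !ch_codegen. Qed.

Program Definition SExt : category := {|
  ob := cosimplicial_ext;
  hom := cosimplicial_hom;
  idc := cosimplicial_id;
  compc := cosimplicial_comp
|}.
Next Obligation. by move=> *; apply: cosimplicial_hom_eq. Qed.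
Next Obligation. by move=> *; apply: cosimplicial_hom_eq. Qed.
Next Obligation. by move=> *; apply: cosimplicial_hom_eq. Qed.

Record vext := VExtension {
  ve_K : groupType;
  ve_G : groupType;
  ve_iota : {multiplicative ve_K -> ve_G};
  ve_proj : {multiplicative ve_G -> V};
  ve_exact : short_exact ve_iota ve_proj
}.

Record vext_hom (X Y : vext) := VExtHom {
  vh_K : {multiplicative ve_K X -> ve_K Y};
  vh_G : {multiplicative ve_G X -> ve_G Y};
  vh_V : {multiplicative V -> V};
  vh_iota : forall k, vh_G (ve_iota X k) = ve_iota Y (vh_K k);
  vh_proj : forall g, ve_proj Y (vh_G g) = vh_V (ve_proj X g)
}.

Lemma vext_hom_eq (X Y : vext) (f g : vext_hom X Y) :
  vh_K f =1 vh_K g -> vh_G f =1 vh_G g -> vh_V f =1 vh_V g -> f = g.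
Proof.
case: f g => [fK fG fV f1 f2] [gK gG gV g1 g2] /=.
move=> /mult_eq eK /mult_eq eG /mult_eq eV; subst gK gG gV.
by congr VExtHom; apply: Prop_irrelevance.
Qed.

Program Definition vext_id (X : vext) : vext_hom X X := {|
  vh_K := mult_id (ve_K X);
  vh_G := mult_id (ve_G X);
  vh_V := mult_id V
|}.
Next Obligation. by []. Qed.
Next Obligation. by []. Qed.

Program Definition vext_comp (X Y Z : vext) (f : vext_hom Y Z)
    (g : vext_hom X Y) : vext_hom X Z := {|
  vh_K := mult_comp (vh_K f) (vh_K g);
  vh_G := mult_comp (vh_G f) (vh_G g);
  vh_V := mult_comp (vh_V f) (vh_V g)
|}.
Next Obligation. by move=> * /=; rewrite !vh_iota. Qed.
Next Obligation. by move=> * /=; rewrite !vh_proj. Qed.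

Program Definition VExt : category := {|
  ob := vext;
  hom := vext_hom;
  idc := vext_id;
  compc := vext_comp
|}.
Next Obligation. by move=> *; apply: vext_hom_eq. Qed.
Next Obligation. by move=> *; apply: vext_hom_eq. Qed.
Next Obligation. by move=> *; apply: vext_hom_eq. Qed.

(* Main.v *)
From HB Require Import structures.
Require Import Defs.
From mathcomp Require Import all_boot perm boolp.

Set Implicit Arguments.
Unset Strict Implicit.
Unset Printing Implicit Defensive.

(** All the groups in the statement ([Kinf], [GV], [V], and Thompson's group
    [F], presented below by pairs of trees) are groups of classes of symbols,
    and all the homomorphisms are induced by homomorphisms of symbols.  The two
    facts on expansions that make this work are that a symbol can be expanded
    until its source tree is any given tree containing the initial one
    ([reach_ex]), and that the expanded symbol is determined by this tree
    ([reach_uniq]).  Therefore an equation in a group of classes becomes, after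
    expansion, an equation between symbols with the same source tree, and a
    homomorphism of symbols passes its levelwise properties on to the classes:
    injectivity ([classes_map_inj]), surjectivity ([classes_map_surj]), and the
    description of the kernel ([classes_map_ker]: an element of the kernel is
    the class of a symbol whose image is an identity).

    Exactness of the sequence of [Kinf], [GV] and [V] is then exactness of the
    extensions at each level: a symbol of [GV] over the identity at the tree t
    has both trees equal to t and its entry in the kernel of [ce_bar], so that
    it comes from [Kinf].

    For the splitting, the neutral elements are preserved by strand doubling,
    so that a pair of trees (t1, t0) gives the symbol (t1, t0, 1) of every
    extension, compatibly with expansions.  This defines a homomorphism from the
    group of pairs of trees to [GV E]; for the extension formed by the symmetric
    groups it is an isomorphism onto [F], and the section is the composite of
    its inverse with the homomorphism to [GV E].

    Functoriality only has to be checked on classes of symbols, where it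
    reduces to that of the formula (t1, t0, g) |-> (t1, t0, f g). *)

Local Open Scope group_scope.

#[local] Obligation Tactic := idtac.

(** * Homomorphisms induced on classes of symbols *)

Section ClassesMapProperties.
Variables (S S' : symbols) (f : symbols_hom S S').

(** Homomorphisms of symbols preserve source trees, so that the image of the
    expansion of x to the source tree of z is z itself. *)
Lemma reach_hom_lift (x : psymbol S) (z : psymbol S') :
  reach (PSymbol (sh_fun f (ps_val x))) z ->
  exists2 y, reach x y & PSymbol (sh_fun f (ps_val y)) = z.
Proof.
move=> xz; have := reach_tsub xz; rewrite {1}/ptree /= sh_src => xT.
have [y xy yT] := reach_ex xT; exists y => //.
by apply: reach_uniq (reach_hom f xy) xz _; rewrite -yT /ptree /= sh_src.
Qed.

(** Two elements with the same image have images with a common expansion z;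
    lifted along f, the expansions to z give two symbols over z, hence equal. *)
Lemma classes_map_inj :
  (forall n, injective (sh_fun f (n := n))) -> injective (classes_map f).
Proof.
move=> f_inj a b.
have [n [x ->]] := class_ofP a; have [m [y ->]] := class_ofP b.
rewrite !classes_map_of => /psclass_eq/equiv_reach[z xz yz].
have [[k x'] xx' ex] := @reach_hom_lift (PSymbol x) z xz.
have [[l y'] yy' ey] := @reach_hom_lift (PSymbol y) z yz.
have e : k = l by move: ey; rewrite -ex => /(congr1 (@ps_level _)).
move: x' y' xx' yy' ex ey; case: l / e => x' y' xx' yy' <- /psymbol_inj/f_inj /= yx.
by rewrite yx in yy'; rewrite /class_of (reach_class xx') -(reach_class yy').
Qed.

Lemma classes_map_surj : (forall n (y : S' n), exists x, sh_fun f x = y) ->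
  forall b, exists a, classes_map f a = b.
Proof.
move=> f_surj b; have [n [y ->]] := class_ofP b; have [x <-] := f_surj n y.
by exists (class_of x); rewrite classes_map_of.
Qed.

(** An expansion z of the image of a symbol of the class a that is also an
    expansion of an identity is an identity, and it lifts to the class a. *)
Lemma classes_map_ker (a : classes S) : classes_map f a = 1 ->
  exists n (x : S n), a = class_of x /\ sh_fun f x = sg_one (sg_src x).
Proof.
have [n [x ->]] := class_ofP a; rewrite classes_map_of.
rewrite -(class_of1 S' (sg_src x)) => /psclass_eq/equiv_reach[z xz oz].
have [[m y] xy ey] := @reach_hom_lift (PSymbol x) z xz.
exists m, y; split; first exact: reach_class xy.
have := reach_one oz; rewrite /= sg_src_one => /(_ erefl).
by rewrite -ey /= sh_src.
Qed.

End ClassesMapProperties.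

(** * The exact sequence *)

Lemma Kinf_GV_inj (E : cosimplicial_ext) : injective (Kinf_GV E).
Proof.
apply: classes_map_inj => n [t k] [u l] /= [-> _ e].
by have [iota_inj _ _] := ce_exact E n; rewrite (iota_inj _ _ e).
Qed.

Lemma GV_exact (E : cosimplicial_ext) : short_exact (Kinf_GV E) (GV_V E).
Proof.
split=> [|a|b]; first exact: Kinf_GV_inj.
  split=> [/classes_map_ker[n [[t1 t0 g] [-> [-> bar_g]]]]|[b <-]].
    have [_ ker _] := ce_exact E n; have [k ek] := (ker g).1 bar_g.
    by exists (Kclass t0 k); rewrite Kinf_GVE ek.
  have [n [[t k] ->]] := class_ofP b.
  have [_ ker _] := ce_exact E n.
  rewrite [class_of _]/(Kclass t k) Kinf_GVE GV_VE (ker _).2; last by exists k.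
  exact: (class_of1 (gsymbols sym_ext) t).
apply: classes_map_surj b => n [t1 t0 s].
have [_ _ /(_ s)[g <-]] := ce_exact E n.
by exists (GSymbol t1 t0 g).
Qed.

(** * The splitting over F *)

Program Definition tree_pairs : symbols := {|
  sg_car n := (ntree n * ntree n)%type;
  sg_src n x := x.2;
  sg_tgt n x := x.1;
  sg_act n x i := i;
  sg_mul n x y := (x.1, y.2);
  sg_one n t := (t, t);
  sg_inv n x := (x.2, x.1);
  sg_expand n i x := (expand i x.1, expand i x.2)
|}.
Next Obligation. by []. Qed.
Next Obligation. by []. Qed.
Next Obligation. by []. Qed.
Next Obligation. by []. Qed.
Next Obligation. by []. Qed.
Next Obligation. by []. Qed.
Next Obligation. by []. Qed.
Next Obligation. by move=> n []. Qed.
Next Obligation. by move=> n []. Qed.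
Next Obligation. by []. Qed.
Next Obligation. by []. Qed.
Next Obligation. by []. Qed.
Next Obligation. by []. Qed.
Next Obligation. by []. Qed.
Next Obligation. by []. Qed.
Next Obligation. by []. Qed.
Next Obligation. by []. Qed.
Next Obligation. by move=> n i j [t1 t0] ji /=; rewrite !expand_comm. Qed.

Program Definition tree_pairs_gsymbols (E : cosimplicial_ext) :
    symbols_hom tree_pairs (gsymbols E) := {|
  sh_fun n x := GSymbol x.1 x.2 1
|}.
Next Obligation. by []. Qed.
Next Obligation. by []. Qed.
Next Obligation. by move=> E n x y /= _; rewrite mulg1. Qed.
Next Obligation. by move=> E n i x /=; rewrite mult1 sym_app1 ce_double1. Qed.

Definition tree_pairs_GV (E : cosimplicial_ext) :
    {multiplicative classes tree_pairs -> GV E} :=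
  classes_map (tree_pairs_gsymbols E).

(** This is why an element of F determines its pairs of trees up to common
    expansions, which makes the section over F well defined. *)
Lemma tree_pairs_V_inj : injective (tree_pairs_GV sym_ext).
Proof. by apply: classes_map_inj => n [t1 t0] [u1 u0] [-> ->]. Qed.

Lemma tree_pairs_VP (x : F) : exists a, tree_pairs_GV sym_ext a = val x.
Proof.
have /asboolP[n [t1 [t0 ->]]] := valP x.
exists (class_of ((t1, t0) : tree_pairs n)).
exact: (classes_map_of (tree_pairs_gsymbols sym_ext)).
Qed.

Lemma tree_pairs_GV_V (E : cosimplicial_ext) a :
  GV_V E (tree_pairs_GV E a) = tree_pairs_GV sym_ext a.
Proof.
have [n [[t1 t0] ->]] := class_ofP a.
by rewrite /tree_pairs_GV /= !classes_map_of /= mult1.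
Qed.

Definition tree_pairs_of_F (x : F) : classes tree_pairs :=
  projT1 (cid (tree_pairs_VP x)).

Lemma tree_pairs_of_FK x : tree_pairs_GV sym_ext (tree_pairs_of_F x) = val x.
Proof. by rewrite /tree_pairs_of_F; case: cid. Qed.

Lemma tree_pairs_of_FM : {morph tree_pairs_of_F : x y / x * y}.
Proof.
by move=> x y; apply: tree_pairs_V_inj; rewrite [RHS]gmulfM !tree_pairs_of_FK.
Qed.

HB.instance Definition _ := isMultiplicative.Build F (classes tree_pairs)
  tree_pairs_of_F tree_pairs_of_FM.

Lemma GV_split (E : cosimplicial_ext) : split_over_F (GV_V E).
Proof.
exists (mult_comp (tree_pairs_GV E) tree_pairs_of_F) => x /=.
by rewrite tree_pairs_GV_V tree_pairs_of_FK.
Qed.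

(** * Functoriality *)

Section Functoriality.
Variables (E E' : cosimplicial_ext) (f : cosimplicial_hom E E').

(** The doublings on the kernels are the restrictions of those on the groups,
    with which f commutes, and the kernels are embedded in the groups. *)
Lemma ch_doubleK n (i : 'I_n.+1) (k : ce_K E n) :
  ch_K f n.+1 (ce_doubleK i k) = ce_doubleK i (ch_K f n k).
Proof.
have [iota_inj _ _] := ce_exact E' n.+1; apply: iota_inj.
by rewrite -ch_iota !ce_iota_double -ch_iota ch_double.
Qed.

Program Definition ksymbols_map : symbols_hom (ksymbols E) (ksymbols E') := {|
  sh_fun n x := (x.1, ch_K f n x.2)
|}.
Next Obligation. by []. Qed.
Next Obligation. by []. Qed.
Next Obligation. by move=> n x y /= _; rewrite gmulfM. Qed.
Next Obligation. by move=> n i x /=; rewrite ch_doubleK. Qed.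

Program Definition gsymbols_map : symbols_hom (gsymbols E) (gsymbols E') := {|
  sh_fun n x := GSymbol (gs_tgt x) (gs_src x) (ch_G f n (gs_elt x))
|}.
Next Obligation. by []. Qed.
Next Obligation. by []. Qed.
Next Obligation. by move=> n x y /= _; rewrite gmulfM. Qed.
Next Obligation. by move=> n i x /=; rewrite ch_bar ch_double. Qed.

Definition Kinf_map : {multiplicative Kinf E -> Kinf E'} :=
  classes_map ksymbols_map.

Definition GV_map : {multiplicative GV E -> GV E'} := classes_map gsymbols_map.

Lemma Kinf_mapE n (t : ntree n) (k : ce_K E n) :
  Kinf_map (Kclass t k) = Kclass t (ch_K f n k).
Proof. exact: (classes_map_of ksymbols_map). Qed.

Lemma GV_mapE n (t1 t0 : ntree n) (g : ce_G E n) :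
  GV_map (Gclass t1 t0 g) = Gclass t1 t0 (ch_G f n g).
Proof. exact: (classes_map_of gsymbols_map). Qed.

End Functoriality.

Lemma KclassP (E : cosimplicial_ext) (a : Kinf E) :
  exists n (t : ntree n) (k : ce_K E n), a = Kclass t k.
Proof. by have [n [[t k] ->]] := class_ofP a; exists n, t, k. Qed.

Lemma GclassP (E : cosimplicial_ext) (a : GV E) :
  exists n (t1 t0 : ntree n) (g : ce_G E n), a = Gclass t1 t0 g.
Proof. by have [n [[t1 t0 g] ->]] := class_ofP a; exists n, t1, t0, g. Qed.

Lemma Kinf_map_id (E : cosimplicial_ext) : Kinf_map (cosimplicial_id E) =1 id.
Proof. by move=> a; have [n [t [k ->]]] := KclassP a; rewrite Kinf_mapE. Qed.

Lemma GV_map_id (E : cosimplicial_ext) : GV_map (cosimplicial_id E) =1 id.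
Proof. by move=> a; have [n [t1 [t0 [g ->]]]] := GclassP a; rewrite GV_mapE. Qed.

Section Composition.
Variables (E1 E2 E3 : cosimplicial_ext).
Variables (f : cosimplicial_hom E2 E3) (g : cosimplicial_hom E1 E2).

Lemma Kinf_map_comp a :
  Kinf_map (cosimplicial_comp f g) a = Kinf_map f (Kinf_map g a).
Proof. by have [n [t [k ->]]] := KclassP a; rewrite !Kinf_mapE. Qed.

Lemma GV_map_comp a : GV_map (cosimplicial_comp f g) a = GV_map f (GV_map g a).
Proof. by have [n [t1 [t0 [x ->]]]] := GclassP a; rewrite !GV_mapE. Qed.

End Composition.

Program Definition GV_functor : @functor_on SExt Grp (fun E => GV E) := {|
  fmap E E' f := GV_map f
|}.
Next Obligation. by move=> E; apply: mult_eq; apply: GV_map_id. Qed.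
Next Obligation. by move=> *; apply: mult_eq; apply: GV_map_comp. Qed.

Program Definition GV_ext_map (E E' : SExt) (f : hom E E') :
    vext_hom (VExtension (GV_exact E)) (VExtension (GV_exact E')) := {|
  vh_K := Kinf_map f;
  vh_G := GV_map f;
  vh_V := mult_id V
|}.
Next Obligation.
move=> E E' f a; have [n [t [k ->]]] := KclassP a.
by rewrite /ve_iota Kinf_mapE !Kinf_GVE GV_mapE ch_iota.
Qed.
Next Obligation.
move=> E E' f a; have [n [t1 [t0 [g ->]]]] := GclassP a.
by rewrite /ve_proj GV_mapE /= !GV_VE ch_bar.
Qed.

Program Definition GV_ext_functor :
    @functor_on SExt VExt (fun E => VExtension (GV_exact E)) := {|
  fmap E E' f := GV_ext_map f
|}.
Next Obligation.
by move=> E; apply: vext_hom_eq; [apply: Kinf_map_id | apply: GV_map_id | ].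
Qed.
Next Obligation.
by move=> *; apply: vext_hom_eq; [apply: Kinf_map_comp | apply: GV_map_comp | ].
Qed.

Theorem proposition8p5 :
  exists exactE : forall E : SExt, short_exact (Kinf_GV E) (GV_V E),
  [/\ forall E : SExt, split_over_F (GV_V E),
      exists Phi : @functor_on SExt VExt (fun E => VExtension (exactE E)),
        forall (E E' : SExt) (f : hom E E'),
        [/\ forall (n : nat) (t : ntree n) (k : ce_K E n),
              vh_K (fmap Phi f) (Kclass t k) = Kclass t (ch_K f n k),
            forall (n : nat) (t1 t0 : ntree n) (g : ce_G E n),
              vh_G (fmap Phi f) (Gclass t1 t0 g) = Gclass t1 t0 (ch_G f n g)
          & forall v : V, vh_V (fmap Phi f) v = v]
    & exists Psi : @functor_on SExt Grp (fun E => GV E),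
        forall (E E' : SExt) (f : hom E E')
               (n : nat) (t1 t0 : ntree n) (g : ce_G E n),
          fmap Psi f (Gclass t1 t0 g) = Gclass t1 t0 (ch_G f n g)].
Proof.
exists GV_exact; split; first exact: GV_split.
  exists GV_ext_functor => E E' f; split=> // [n t k|n t1 t0 g].
    exact: Kinf_mapE.
  exact: GV_mapE.
by exists GV_functor => E E' f n t1 t0 g; apply: GV_mapE.
Qed.
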